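(* Let $d\ge 2$ and let $X\subseteq\{0,1\}^{\mathbb{N}^d}$ be an $\mathbb{N}^d$ shift. Then $h(X)>0$ if and only if there exists an independence set $S\subseteq\mathbb{N}^d$ of $X$ with positive upper density, $\overline{d}(S)>0$.
   Context: $\mathbb{N}=\{1,2,\dots\}$ and $[1,n]=\{1,\dots,n\}$. For a finite alphabet $\mathcal{A}$, an $\mathbb{N}^d$ shift over $\mathcal{A}$ is a closed (product topology) subset $X\subseteq\mathcal{A}^{\mathbb{N}^d}$ that is mapped into itself by all shifts $(x_{\mathbf{i}})_{\mathbf{i}}\mapsto(x_{\mathbf{i}+\mathbf{e}_k})_{\mathbf{i}}$, $1\le k\le d$, where $\mathbf{e}_k$ is the $k$-th standard unit vector. Its (topological) entropy is $$h(X)=\lim_{n_1,\dots,n_d\to\infty}\frac{\log|B_{n_1,\dots,n_d}(X)|}{n_1\cdots n_d},$$ where $B_{n_1,\dots,n_d}(X)$ is the set of all $n_1\times\cdots\times n_d$ blocks appearing in points of $X$. A set $S\subseteq\mathbb{N}^d$ is an independence set of $X$ (equivalently, $X$ is independent over $S$) if for every $u\in\mathcal{A}^S$ there is $x\in X$ with $x_{\mathbf{i}}=u_{\mathbf{i}}$ for all $\mathbf{i}\in S$. The upper density of $S\subseteq\mathbb{N}^d$ is $$\overline{d}(S)=\limsup_{n_1,\dots,n_d\to\infty}\frac{|S\cap\prod_{i=1}^d[1,n_i]|}{|\prod_{i=1}^d[1,n_i]|},$$ where the limsup is taken as all of $n_1,\dots,n_d$ tend to infinity jointly, i.e. it equals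 $\inf_{N}\sup_{n_1,\dots,n_d\ge N}$ of the quotient. *)

(* Defs.v *)
From HB Require Import structures.
From mathcomp Require Import all_boot all_order all_algebra.
From mathcomp Require Import all_classical all_reals all_analysis.

Set Implicit Arguments.
Unset Strict Implicit.
Unset Printing Implicit Defensive.

Import Order.TTheory GRing.Theory Num.Theory.
Import numFieldNormedType.Exports.

Local Open Scope classical_set_scope.
Local Open Scope ring_scope.

(* The index semigroup N^d with N = {1, 2, ...} is represented through the
   translation-equivariant bijection i |-> i - (1, ..., 1): coordinates start
   at 0, and [1, n_1] x ... x [1, n_d] becomes the set of indices whose k-th
   coordinate is < n_k.  The same type, without the re-indexing, is used for
   tuples (n_1, ..., n_d) of side lengths. *)
Definition multi_index (d : nat) := {ffun 'I_d -> nat}.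

(* bool carries its discrete topology, so this is {0,1}^(N^d) with the product
   topology. *)
Definition config (d : nat) := prod_topology (fun _ : multi_index d => bool).

Definition unit_index (d : nat) (k : 'I_d) : multi_index d :=
  [ffun l => nat_of_bool (l == k)].

Definition shift_map (d : nat) (k : 'I_d) (x : config d) : config d :=
  fun i => x (i + unit_index k).

Definition is_shift (d : nat) (X : set (config d)) : Prop :=
  closed X /\ forall (k : 'I_d) (x : config d), X x -> X (shift_map k x).

Definition box (d : nat) (n : multi_index d) := {dffun forall k : 'I_d, 'I_(n k)}.

Definition box_index (d : nat) (n : multi_index d) (c : box n) : multi_index d :=
  [ffun k => nat_of_ord (c k)].

Definition block (d : nat) (n : multi_index d) := {ffun box n -> bool}.

Definition appears (d : nat) (n : multi_index d) (b : block n) (x : config d) : Prop :=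
  exists p : multi_index d, forall c : box n, x (p + box_index c) = b c.

Definition num_blocks (d : nat) (X : set (config d)) (n : multi_index d) : nat :=
  #|[pred b : block n | `[< exists2 x, X x & appears b x >]]|.

Definition orthant (d N : nat) : set (multi_index d) :=
  [set n | forall k : 'I_d, (N <= n k)%N].
Arguments orthant : clear implicits.

(* The filter "n_1, ..., n_d -> oo jointly". *)
Definition index_oo (d : nat) : set_system (multi_index d) :=
  filter_from [set: nat] (orthant d).
Arguments index_oo : clear implicits.

(* Extended-real valued, since log 0 = -oo for the empty shift. *)
Definition entropy (R : realType) (d : nat) (X : set (config d)) : \bar R :=
  lim ((lne ((num_blocks X n)%:R%:E) * ((\prod_(k < d) n k)%N%:R^-1)%:E)%E
       @[n --> index_oo d]).

(* Elements u of {0,1}^S are given by arbitrary extensions to all indices. *)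
Definition independent (d : nat) (X : set (config d)) (S : set (multi_index d)) : Prop :=
  forall u : multi_index d -> bool,
  exists x : config d, X x /\ forall i : multi_index d, S i -> x i = u i.

Definition density_in_box (R : realType) (d : nat) (S : set (multi_index d))
    (n : multi_index d) : R :=
  #|[pred c : box n | `[< S (box_index c) >]]|%:R / #|{: box n}|%:R.

Definition upper_density (R : realType) (d : nat) (S : set (multi_index d)) :
    \bar R :=
  ereal_inf [set ereal_sup [set (density_in_box R S n)%:E | n in orthant d N]
            | N in [set: nat]].

Lemma index_oo_filter (d : nat) : ProperFilter (index_oo d).
Proof.
apply: filter_from_proper; last first.
  by move=> N _; exists [ffun=> N] => k; rewrite ffunE.
apply: filter_from_filter; first by exists 0%N.
move=> N M _ _; exists (maxn N M) => // n nNM; split => k.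
  by apply: leq_trans (nNM k); rewrite leq_maxl.
by apply: leq_trans (nNM k); rewrite leq_maxr.
Qed.
#[global] Existing Instance index_oo_filter.

Lemma card_box (d : nat) (n : multi_index d) : #|{: box n}| = (\prod_(k < d) n k)%N.
Proof.
rewrite card_dep_ffun foldrE big_image /=.
by apply: eq_bigr => k _; rewrite card_ord.
Qed.

(* Main.v *)
Require Import Defs.
From mathcomp Require Import all_boot all_order all_algebra.
From mathcomp Require Import all_classical all_reals all_analysis.
From mathcomp Require Import zify ring lra.

Set Implicit Arguments.
Unset Strict Implicit.
Unset Printing Implicit Defensive.

Import Order.TTheory GRing.Theory Num.Theory.
Import numFieldNormedType.Exports.

Local Open Scope classical_set_scope.
Local Open Scope ring_scope.

(** The whole proof turns on the sets [S] over which [X] is independent.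

    Positive density gives positive entropy: if [X] is independent over [S],
    then every box [n] carries at least [2 ^ #|S in n|] blocks of [X].  Blocks
    over a large box are determined by the blocks over the tiles of a smaller
    box, so [log |B_n|] is subadditive, the entropy is an honest limit, and it
    is the infimum of [log |B_n| / |n|] (Fekete's argument, [fekete_box]).
    Hence a lower bound for the normalised logarithm along arbitrarily large
    boxes is one for the entropy.

    Positive entropy gives positive density, first at finite scale: a family of
    [e^(hV)] binary words on [V] coordinates shatters a set of at least
    [(h^2 / 9) V] coordinates, by Pajor's form of the Sauer-Shelah lemma
    ([shatters_large]).  A set shattered by the blocks over a cube is an
    independence set.  So every cube contains an independence set of density
    at least a fixed constant.

    What remains is to glue these finite sets, of unrelated shapes, into one set
    that is dense in infinitely many cubes based at the origin.  Let [a N] be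
    the largest size of an independence set inside the cube of side [N] and let
    [D] be the lower limit of [a N / N^d], which is positive.  Choose sides
    [n_0, n_1, ...] at which [a (n_j) / n_j^d] is at most [D + e_j] with
    summable small [e_j].  In an optimal independence set of a huge cube, the
    windows of side [n_j] have average density close to [D], and none has
    density above [D + e_j], because a translate of an independence set is an
    independence set.  An average close to the maximum means that few windows
    fall below [D / 2]; the exceptional fractions being summable, one base point
    is good at all of the first [k] scales at once ([dense_at_many_scales]).
    Letting [k] grow along an ultrafilter, the translates converge to a set that
    is still independent, because [X] is compact, and has density at least
    [D / 2] at every scale ([independent_compactness]). *)

(** * Shattering: the Sauer-Shelah lemma in linear-density form *)

Definition shatters (I : finType) (F : {set {ffun I -> bool}}) (A : {set I}) : bool :=
  [forall u : {ffun I -> bool}, [exists f in F, [forall i in A, f i == u i]]].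

Lemma shattersP (I : finType) (F : {set {ffun I -> bool}}) (A : {set I}) :
  reflect (forall u : {ffun I -> bool}, exists2 f, f \in F & {in A, f =1 u})
    (shatters F A).
Proof.
apply: (iffP forallP) => H u.
  have /existsP[f /andP[fF /forallP fu]] := H u; exists f => // i iA.
  by have /implyP/(_ iA)/eqP := fu i.
have [f fF fu] := H u; apply/existsP; exists f; rewrite fF /=.
by apply/forallP => i; apply/implyP => iA; rewrite fu.
Qed.

Lemma shatters_sub (I : finType) (F G : {set {ffun I -> bool}}) (A : {set I}) :
  F \subset G -> shatters F A -> shatters G A.
Proof.
move=> FG /shattersP H; apply/shattersP => u.
by have [f fF fu] := H u; exists f => //; apply: (fintype.subsetP FG).
Qed.

(** Pajor's inequality.  Split [F] by the value at a coordinate [i] on which it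
    is not constant.  No set shattered by a half contains [i], and if both halves
    shatter [A] then [F] shatters both [A] and [i |: A]; so [F] shatters at
    least as many sets as the two halves together, and induction applies. *)
Lemma card_le_shattered (I : finType) (F : {set {ffun I -> bool}}) :
  (#|F| <= #|[set A | shatters F A]%SET|)%N.
Proof.
have [m] := ubnP #|F|; elim: m F => // m IH F; rewrite ltnS => Fm.
have [F0|] := leqP #|F| 1.
  have [->|[f fF]] := set_0Vmem F; first by rewrite cards0.
  apply: leq_trans F0 _; apply/card_gt0P; exists finset.set0; rewrite inE.
  by apply/shattersP => u; exists f => // i; rewrite inE.
move=> /card_gt1P[f [g [fF gF fg]]].
have [i fgi] : exists i, f i != g i.
  apply/existsP; rewrite -negb_forall; apply: contra fg => /forallP h.
  by apply/eqP/ffunP => i; apply/eqP.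
pose Fb b := [set f in F | f i == b]%SET.
have Fbs b : Fb b \subset F by apply/fintype.subsetP => h; rewrite inE => /andP[].
have Fb0 b : (0 < #|Fb b|)%N.
  apply/card_gt0P; have [fb|fb] := eqVneq (f i) b; first by exists f; rewrite inE fF fb eqxx.
  by exists g; rewrite inE gF /=; move: fgi fb; case: (f i) (g i) b => [] [] [].
have FU : (#|F| = #|Fb true| + #|Fb false|)%N.
  rewrite -(cardsID [set f : {ffun I -> bool} | f i]%SET F); congr addn; apply: eq_card => h;
  by rewrite !inE; case: (h i); rewrite ?andbT ?andbF.
pose Sb b := [set A | shatters (Fb b) A]%SET.
have Sbs b : Sb b \subset [set A | shatters F A]%SET.
  by apply/fintype.subsetP => A; rewrite !inE; apply: shatters_sub.
have Sbi b A : A \in Sb b -> i \notin A.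
  rewrite inE => /shattersP H; apply/negP => iA.
  have [h] := H [ffun=> ~~ b]; rewrite inE => /andP[_ /eqP hb] /(_ i iA).
  by rewrite ffunE hb; case: (b).
have [lt lf] : (#|Fb true| < m)%N /\ (#|Fb false| < m)%N.
  by move: (Fb0 true) (Fb0 false); lia.
rewrite FU; apply: (leq_trans (leq_add (IH _ lt) (IH _ lf))).
rewrite -/(Sb true) -/(Sb false) -cardsUI.
set U := Sb true :|: Sb false; set V := Sb true :&: Sb false.
have inj : {in V &, injective (fun A => i |: A)}.
  move=> A B /finset.setIP[/Sbi iA _] /finset.setIP[/Sbi iB _] /(congr1 (fun C => C :\ i)).
  by rewrite !setU1K.
(* the sets shattered by both halves are counted a second time through the
   injection [A |-> i |: A], whose values contain [i] and so are new *)
rewrite -(card_in_imset inj) -cardsUI.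
have -> : (U :&: [set i |: x | x in V])%SET = finset.set0.
  apply/finset.setP => B; rewrite finset.in_set0; apply/negbTE/negP; rewrite inE => /andP[BU /imsetP[A _ BA]].
  by move: BU; rewrite BA inE => /orP[] /Sbi; rewrite setU11.
rewrite cards0 addn0; apply: subset_leq_card; rewrite finset.subUset; apply/andP; split.
  by rewrite finset.subUset !Sbs.
apply/fintype.subsetP => B /imsetP[A /finset.setIP[At Af] ->]; rewrite inE.
apply/shattersP => u.
have : A \in Sb (u i) by case: (u i).
rewrite inE => /shattersP /(_ u)[h hF hu]; exists h.
  exact: (fintype.subsetP (Fbs (u i))).
by move=> j; rewrite !inE => /orP[/eqP -> | /hu//]; move: hF; rewrite inE => /andP[_ /eqP].
Qed.

Lemma sum_pow_card (R : comNzRingType) (I : finType) (x : R) :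
  \sum_(A : {set I}) x ^+ #|A| = (1 + x) ^+ #|I|.
Proof.
rewrite addrC -prodr_const (eq_bigl xpredT) // bigA_distr; apply: eq_big => A; first by rewrite inE.
by move=> _; rewrite -big_mkcond /= prodr_const.
Qed.

(** If all shattered sets had fewer than [dl V] elements, weighting each of them
    by [exp (t (dl V - #|A|)) >= 1] in Pajor's inequality would give
    [#|F| <= exp (t dl V) (1 + exp (- t))^V], since the sum of [x^#|A|] over all
    sets is [(1 + x)^V].  With [t = 3 / h] and [dl = h^2 / 9] both factors are at
    most [exp (h V / 3)], which is too small. *)
Lemma shatters_large (R : realType) (I : finType) (F : {set {ffun I -> bool}}) (h : R) :
  0 < h -> (0 < #|I|)%N -> expR (h * #|I|%:R) <= #|F|%:R ->
  exists2 A : {set I}, shatters F A & h ^+ 2 / 9 * #|I|%:R <= #|A|%:R.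
Proof.
move=> h0 I0 hF; apply: contrapT => noA.
set V : R := #|I|%:R in hF noA *.
have V0 : 0 < V by rewrite ltr0n.
pose t := 3 / h; have t0 : 0 < t by rewrite divr_gt0.
have : #|F|%:R <= expR (t * (h ^+ 2 / 9 * V)) * (1 + expR (- t)) ^+ #|I| :> R.
  rewrite -sum_pow_card mulr_sumr.
  apply: (@le_trans _ _ (\sum_(A : {set I} | shatters F A) 1)).
    by rewrite sumr_const ler_nat; have := card_le_shattered F; rewrite cardsE.
  rewrite [leRHS](bigID (shatters F)) /= -[leLHS]addr0; apply: lerD; last first.
    by apply: sumr_ge0 => A _; rewrite mulr_ge0 ?exprn_ge0 ?expR_ge0.
  apply: ler_sum => A sA; rewrite -expRM_natl -expRD -[leLHS]expR0 ler_expR.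
  have : #|A|%:R <= h ^+ 2 / 9 * V.
    by rewrite leNgt; apply/negP => /ltW ?; apply: noA; exists A.
  move=> HA; rewrite mulrN [#|A|%:R * t]mulrC -mulrBr mulr_ge0 ?subr_ge0 //; exact: ltW.
apply/negP; rewrite -ltNge; apply: lt_le_trans hF.
have e1 : expR (- t) <= h / 3.
  rewrite expRN -[h / 3]invrK lef_pV2 ?posrE ?expR_gt0 ?invr_gt0 ?divr_gt0 //.
  rewrite invf_div -/t; apply: le_trans (expR_ge1Dx t); lra.
have e2 : (1 + expR (- t)) ^+ #|I| <= expR (h / 3 * V).
  rewrite /V expRM_natr; apply: lerXn2r; rewrite ?nnegrE ?addr_ge0 ?expR_ge0 //.
  by apply: le_trans (expR_ge1Dx _); rewrite lerD2l.
apply: (@le_lt_trans _ _ (expR (t * (h ^+ 2 / 9 * V)) * expR (h / 3 * V))).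
  by rewrite ler_pM2l ?expR_gt0.
rewrite -expRD ltr_expR /t.
have -> : 3 / h * (h ^+ 2 / 9 * V) + h / 3 * V = h * V - h * V / 3 by field; lra.
by rewrite ltrBlDr ltrDl divr_gt0 // mulr_gt0.
Qed.

(** * Boxes, blocks and translations *)

Lemma multi_index_addE (d : nat) (p q : multi_index d) (k : 'I_d) : (p + q) k = (p k + q k)%N.
Proof. by rewrite ffunE. Qed.

Lemma box_index_inj (d : nat) (n : multi_index d) : injective (@box_index d n).
Proof.
move=> b c /ffunP bc; apply/ffunP => k; apply: val_inj.
by have := bc k; rewrite !ffunE.
Qed.

Lemma box_index_surj (d : nat) (n i : multi_index d) :
  (forall k, i k < n k)%N -> exists c : box n, box_index c = i.
Proof.
move=> h; exists [ffun k => Ordinal (h k)].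
by apply/ffunP => k; rewrite !ffunE.
Qed.

(** Invariance under the unit shifts propagates to all translations, one unit
    of [p] at a time. *)
Lemma shift_add (d : nat) (X : set (config d)) (x : config d) (p : multi_index d) :
  is_shift X -> X x -> X (fun i => x (i + p)).
Proof.
move=> [_ Xs]; have [m] := ubnP (\sum_k p k)%N; elim: m p x => // m IH p x.
rewrite ltnS => pm Xx.
have [p0|] := pselect (exists k, (0 < p k)%N); last first.
  move=> np; suff -> : p = 0 by under eq_fun do rewrite addr0.
  apply/ffunP => k; rewrite [RHS]ffunE; apply/eqP; rewrite -leqn0 leqNgt.
  by apply/negP => pk; apply: np; exists k.
have {p0} [k pk] := p0.
pose q : multi_index d := [ffun l => (p l - (l == k))%N].
have pE : p = q + unit_index k.
  apply/ffunP => l; rewrite multi_index_addE !ffunE.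
  by have [->|_] := eqVneq l k; rewrite /= ?subnK // subn0 addn0.
have qm : (\sum_l q l < m)%N.
  apply: leq_trans pm; rewrite pE; under [ltnRHS]eq_bigr do rewrite multi_index_addE.
  rewrite big_split /= -[ltnLHS]addn0 ltn_add2l (bigD1 k) //= ffunE eqxx.
  by rewrite add1n.
have := IH q _ qm (Xs k x Xx); rewrite /shift_map pE.
by under eq_fun do rewrite -addrA.
Qed.

(** By shift invariance a block that appears anywhere also appears at the origin
    ([num_blocksE]); anchoring blocks there makes restriction arguments direct. *)
Definition blocks (d : nat) (X : set (config d)) (n : multi_index d) : {set block n} :=
  [set b : block n | `[< exists2 x, X x & forall c, x (box_index c) = b c >]]%SET.

Lemma blocksP (d : nat) (X : set (config d)) (n : multi_index d) (b : block n) :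
  reflect (exists2 x, X x & forall c, x (box_index c) = b c) (b \in blocks X n).
Proof. by rewrite [_ \in _]inE; apply: asboolP. Qed.

Lemma num_blocksE (d : nat) (X : set (config d)) (n : multi_index d) :
  is_shift X -> num_blocks X n = #|blocks X n|.
Proof.
move=> Xs; apply: eq_card => b; rewrite [RHS]inE [LHS]unfold_in.
apply: asbool_equiv_eq; split.
  move=> [x Xx [p hp]]; exists (fun i => x (i + p)); first exact: (shift_add p Xs Xx).
  by move=> c; rewrite addrC.
by move=> [x Xx h]; exists x => //; exists 0 => c; rewrite add0r.
Qed.

Lemma num_blocks_gt0 (d : nat) (X : set (config d)) (n : multi_index d) :
  is_shift X -> X !=set0 -> (0 < num_blocks X n)%N.
Proof.
move=> Xs [x Xx]; rewrite num_blocksE //; apply/card_gt0P.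
by exists [ffun c => x (box_index c)]; apply/blocksP; exists x => // c; rewrite ffunE.
Qed.

(** Submultiplicativity of the block count in the form used by Fekete's argument:
    cover the box [n] by the tiles of a [q]-shaped grid of copies of [m], and
    record, for one chosen point of [X] extending each block, its restriction to
    every tile.  The extension is what makes sense of tiles sticking out of
    [n]. *)
Lemma num_blocks_tiling (d : nat) (X : set (config d)) (m n q : multi_index d) :
  is_shift X -> (forall k, 0 < m k)%N -> (forall k, n k <= q k * m k)%N ->
  (num_blocks X n <= num_blocks X m ^ (\prod_k q k))%N.
Proof.
move=> Xs m0 nqm; rewrite !num_blocksE // -card_box -card_ffun_on.
have [ext extP] : exists ext : block n -> config d, forall b, b \in blocks X n ->
    X (ext b) /\ forall c, ext b (box_index c) = b c.
  suff /choice[f fP] : forall b : block n, exists x : config d, b \in blocks X n ->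
    X x /\ forall c, x (box_index c) = b c by exists f.
  move=> b; have [/blocksP[x Xx xb]|_] := boolP (b \in blocks X n); first by exists x.
  by exists (fun=> true).
pose corner (t : box q) : multi_index d := [ffun k => (t k * m k)%N].
pose phi (b : block n) : {ffun box q -> block m} :=
  [ffun t => [ffun c => ext b (box_index c + corner t)]].
have phi_inj : {in blocks X n &, injective phi}.
  move=> b b' /extP[Xb bE] /extP[Xb' bE'] /ffunP phibb'; apply/ffunP => c.
  rewrite -bE -bE'.
  have [t tE] : exists t : box q, box_index t = [ffun k => (c k %/ m k)%N].
    apply: box_index_surj => k; rewrite ffunE ltn_divLR //.
    exact: leq_trans (ltn_ord _) (nqm k).
  have [e eE] : exists e : box m, box_index e = [ffun k => (c k %% m k)%N].
    by apply: box_index_surj => k; rewrite ffunE ltn_mod.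
  (* Euclidean division of [c] by [m] gives its tile and its place in the tile *)
  have -> : box_index c = box_index e + corner t.
    apply/ffunP => k; rewrite multi_index_addE eE !ffunE addnC.
    have := congr1 (fun f : multi_index d => f k) tE; rewrite !ffunE => ->.
    exact: divn_eq.
  by have /ffunP/(_ e) := phibb' t; rewrite !ffunE.
rewrite -(card_in_imset phi_inj); apply: subset_leq_card.
apply/fintype.subsetP => _ /imsetP[b /extP[Xb _] ->]; apply/ffun_onP => t.
apply/blocksP; exists (fun i => ext b (i + corner t)); first exact: (shift_add _ Xs Xb).
by move=> c; rewrite !ffunE.
Qed.

Definition count_in (d : nat) (S : set (multi_index d)) (n : multi_index d) : nat :=
  #|[set c : box n | `[< S (box_index c) >]]%SET|.

(** Distinct subsets of [S] inside the box prescribe distinct blocks. *)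
Lemma exp_count_le_num_blocks (d : nat) (X : set (config d)) (S : set (multi_index d))
    (n : multi_index d) :
  is_shift X -> independent X S -> (2 ^ count_in S n <= num_blocks X n)%N.
Proof.
move=> Xs indS; rewrite num_blocksE // /count_in -card_powerset.
set A := (X in powerset X).
have /choice[ext extP] : forall B : {set box n}, exists x : config d, X x /\
    forall c, S (box_index c) -> x (box_index c) = (c \in B).
  move=> B; have [x [Xx xE]] := indS (fun i => [exists c in B, box_index c == i]).
  exists x; split=> // c /xE ->; apply/existsP/idP => [[e /andP[eB /eqP/box_index_inj <-]]//|cB].
  by exists c; rewrite cB eqxx.
pose phi B : block n := [ffun c => ext B (box_index c)].
have phi_inj : {in powerset A &, injective phi}.
  move=> B C; rewrite !inE => /fintype.subsetP BA /fintype.subsetP CA /ffunP BC.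
  apply/finset.setP => c; have [cA|ncA] := boolP (c \in A).
    have := BC c; rewrite !ffunE; move: cA; rewrite inE => /asboolP Sc.
    by rewrite !(extP _).2.
  by rewrite (contraNF (BA c) ncA) (contraNF (CA c) ncA).
rewrite -(card_in_imset phi_inj); apply: subset_leq_card.
apply/fintype.subsetP => _ /imsetP[B _ ->]; apply/blocksP.
by exists (ext B); [exact: (extP B).1|move=> c; rewrite ffunE].
Qed.

(** * Fekete's lemma over boxes and the entropy as an infimum *)

(** Convexity: on [0, 1] the power lies below its chord, which has slope [2^d - 1]. *)
Lemma expr1D_le_lin (R : realFieldType) (d : nat) (t : R) :
  0 <= t <= 1 -> (1 + t) ^+ d <= 1 + 2 ^+ d * t.
Proof.
move=> /andP[t0 t1]; suff h : (1 + t) ^+ d <= 1 + (2 ^+ d - 1) * t by apply: le_trans h _; lra.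
elim: d => [|d IH]; first by rewrite !expr0; lra.
rewrite !exprS; apply: le_trans (ler_wpM2l _ IH) _; first by lra.
have : 1 <= (2 : R) ^+ d by apply: exprn_ege1; lra.
move=> P1; have : 0 <= (2 ^+ d - 1) * (t * (1 - t)) by rewrite !mulr_ge0 ?subr_ge0.
lra.
Qed.

(** The limit is the infimum of [a m / |m|].  Given [m] almost attaining it, a box
    [n] with all sides large is covered by tiles of total volume at most the
    product of the [n k + m k], which is [(1 + t)^d |n|] when [m k <= t n k]. *)
Lemma fekete_box (R : realType) (d : nat) (a : multi_index d -> R) :
  (forall n, 0 <= a n) ->
  (forall m n q : multi_index d, (forall k, 0 < m k)%N ->
    (forall k, n k <= q k * m k)%N -> a n <= (\prod_k q k)%N%:R * a m) ->
  exists L : R,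
    (forall n : multi_index d, (forall k, 0 < n k)%N -> L * (\prod_k n k)%N%:R <= a n) /\
    forall e, 0 < e -> exists N, forall n, orthant d N n ->
      a n <= (L + e) * (\prod_k n k)%N%:R.
Proof.
move=> a0 atile.
have vol0 (n : multi_index d) : (forall k, 0 < n k)%N -> 0 < (\prod_k n k)%N%:R :> R.
  by move=> n0; rewrite ltr0n prodn_gt0.
pose E := [set a m / (\prod_k m k)%N%:R | m in [set m : multi_index d | forall k, (0 < m k)%N]].
have Einf : has_inf E.
  split; last by exists 0 => _ [m _ <-]; rewrite divr_ge0.
  pose m : multi_index d := [ffun=> 1%N]; exists (a m / (\prod_k m k)%N%:R).
  by exists m => // k; rewrite ffunE.
exists (inf E); split=> [n n0|e e0].
  rewrite -ler_pdivlMr ?vol0 //; apply: ge_inf; first exact: Einf.2.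
  by exists n.
have e20 : 0 < e / 2 by rewrite divr_gt0.
have [_ [m m0 <-] mE] := inf_adherent e20 Einf.
set C := a m / _ in mE.
have C0 : 0 <= C by rewrite divr_ge0.
have aE : a m = C * (\prod_k m k)%N%:R by rewrite divfK // gt_eqF ?vol0.
(* chosen so that [C (1 + 2^d t) <= C + e / 2] *)
pose t := Num.min 1 (e / 2 / (2 ^+ d * (C + 1))).
have den0 : 0 < 2 ^+ d * (C + 1) by rewrite mulr_gt0 ?exprn_gt0 //; lra.
have t0 : 0 < t by rewrite lt_min ltr01 divr_gt0.
have t1 : t <= 1 by rewrite ge_min lexx.
have te : C * (2 ^+ d * t) <= e / 2.
  have : t <= e / 2 / (2 ^+ d * (C + 1)) by rewrite ge_min lexx orbT.
  rewrite ler_pdivlMr // => te; apply: le_trans te.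
  have : 0 <= 2 ^+ d * t by rewrite mulr_ge0 ?exprn_ge0 // ltW.
  by nra.
pose N := (Num.trunc ((\sum_k m k)%N%:R / t)).+1.
exists N => n nN.
have mt k : (m k)%:R <= t * (n k)%:R :> R.
  rewrite mulrC -ler_pdivrMr //; apply: (@le_trans _ _ N%:R); last by rewrite ler_nat.
  apply: ltW; apply: le_lt_trans (truncnS_gt _).
  rewrite ler_pM2r ?invr_gt0 // ler_nat (bigD1 k) //=; exact: leq_addr.
pose q : multi_index d := [ffun k => (n k %/ m k).+1].
have nqm k : (n k <= q k * m k)%N by rewrite ffunE ltnW // ltn_ceil.
apply: le_trans (atile m n q m0 nqm) _; rewrite aE mulrCA -natrM -big_split /=.
apply: (@le_trans _ _ (C * ((1 + t) ^+ d * (\prod_k n k)%N%:R))).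
  apply: ler_wpM2l => //; rewrite !natr_prod -[d in (1 + t) ^+ d]card_ord -prodr_const.
  rewrite -big_split /=; apply: ler_prod => k _; rewrite ler0n /=.
  rewrite mulrDl mul1r; apply: le_trans (_ : (n k + m k)%:R <= _).
    by rewrite ler_nat ffunE mulSn addnC leq_add2r leq_divM.
  by rewrite natrD lerD2l.
rewrite mulrA ler_wpM2r //.
have := @expr1D_le_lin _ d t; rewrite (ltW t0) t1 => /(_ isT) ht.
apply: le_trans (ler_wpM2l C0 ht) _; rewrite mulrDr mulr1.
by have := lerD (ltW mE) te; lra.
Qed.

Lemma entropy_set0 (R : realType) (d : nat) : entropy R (@set0 (config d)) = -oo%E.
Proof.
apply: cvg_lim; first exact: ereal_hausdorff.
apply: cvg_near_cst; exists 1%N => // n n1 /=.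
have -> : num_blocks (@set0 (config d)) n = 0%N.
  apply: eq_card0 => b; rewrite [LHS]unfold_in; apply/negbTE/negP => /asboolP.
  by case.
rewrite lexx gt0_mulNye // lte_fin invr_gt0 ltr0n.
by apply: prodn_gt0 => k; apply: n1.
Qed.

(** Besides evaluating the entropy, this supplies the two estimates used later: the
    lower one holds for every box, so positive entropy gives many blocks at each
    scale; the upper one turns many blocks along large boxes into positive
    entropy. *)
Lemma entropy_fekete (R : realType) (d : nat) (X : set (config d)) :
  is_shift X -> X !=set0 ->
  exists L : R, [/\ entropy R X = L%:E,
    forall n : multi_index d, (forall k, 0 < n k)%N ->
      L * (\prod_k n k)%N%:R <= ln (num_blocks X n)%:R &
    forall e, 0 < e -> exists N, forall n, orthant d N n ->
      ln (num_blocks X n)%:R <= (L + e) * (\prod_k n k)%N%:R].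
Proof.
move=> Xs X0; have nb0 n := num_blocks_gt0 n Xs X0.
have [||L [Ll Lu]] := @fekete_box R d (fun n => ln (num_blocks X n)%:R).
- by move=> n; apply: ln_ge0; rewrite ler1n.
- move=> m n q m0 nqm; rewrite mulr_natl -lnXn ?ltr0n // -natrX.
  by rewrite ler_ln ?posrE ?ltr0n ?expn_gt0 ?nb0 // ler_nat num_blocks_tiling.
exists L; split=> //; apply: cvg_lim; first exact: ereal_hausdorff.
apply: cvg_EFin.
  by apply: nearW => n; rewrite lne_EFin ?ltr0n.
apply/cvgrPdist_le => e e0; have [N HN] := Lu e e0.
exists (maxn N 1) => // n nN /=.
have n0 k : (0 < n k)%N by apply: leq_trans (nN k); rewrite leq_maxr.
have v0 : 0 < (\prod_k n k)%N%:R :> R by rewrite ltr0n prodn_gt0.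
rewrite lern0 gtn_eqF ?nb0 //= distrC ler_distl.
have := Ll n n0; rewrite -ler_pdivlMr // => La.
rewrite ler_pdivrMr // HN ?andbT.
  by apply: le_trans La; rewrite lerBlDr lerDl ltW.
by move=> k; apply: leq_trans (nN k); rewrite leq_maxl.
Qed.

(** * Translates and limits of independence sets *)

Definition translate (d : nat) (S : set (multi_index d)) (p : multi_index d) :
  set (multi_index d) := [set i | S (i + p)].

Lemma independent_sub (d : nat) (X : set (config d)) (S T : set (multi_index d)) :
  S `<=` T -> independent X T -> independent X S.
Proof.
by move=> ST indT u; have [x [Xx xu]] := indT u; exists x; split=> // i /ST /xu.
Qed.

(** A pattern on the translate is moved to [S] by subtracting [p]; truncated
    subtraction is harmless, since only indices of the form [i + p] matter. *)
Lemma independent_translate (d : nat) (X : set (config d)) (S : set (multi_index d))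
    (p : multi_index d) :
  is_shift X -> independent X S -> independent X (translate S p).
Proof.
move=> Xs indS u; have [x [Xx xu]] := indS (fun j => u [ffun k => (j k - p k)%N]).
exists (fun i => x (i + p)); split; first exact: (shift_add p Xs Xx).
move=> i Si; rewrite xu //; congr u; apply/ffunP => k.
by rewrite ffunE multi_index_addE addnK.
Qed.

(** Points of the Cantor space converge along an ultrafilter coordinatewise: each
    bit is eventually constant.  This gives the compactness of [X], and at the
    same time limits of subsets of the index set. *)
Definition ultralim (d : nat) (F : set_system nat) (x : nat -> config d) : config d :=
  fun i => `[< F [set k | x k i] >].

Lemma ultralim_near (d : nat) (F : set_system nat) (x : nat -> config d)
    (i : multi_index d) :
  UltraFilter F -> F [set k | x k i = ultralim F x i].
Proof.
move=> FU; rewrite /ultralim; have [Fx|nFx] := asboolP (F [set k | x k i]).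
  exact: Fx.
have [//|] := in_ultra_setVsetC [set k | x k i] FU.
by apply: filterS => k /= /negP /negbTE.
Qed.

Lemma ultralim_cvg (d : nat) (F : set_system nat) (x : nat -> config d) :
  UltraFilter F -> x k @[k --> F] --> ultralim F x.
Proof.
move=> FU; apply/cvg_sup => i; apply/cvg_image.
  apply/seteqP; split=> // b _; by exists (fun=> b).
move=> A /nbhs_singleton Ai; exists [set f : config d | A (f i)].
  rewrite fmapE nbhs_filterE; apply: filterS (ultralim_near x i FU) => k xk.
  by rewrite /preimage /= xk.
by apply/seteqP; split=> [_ [f ? <-]//|b Ab]; exists (fun=> b).
Qed.

Lemma ultralim_closed (d : nat) (X : set (config d)) (F : set_system nat)
    (x : nat -> config d) :
  UltraFilter F -> closed X -> (forall k, X (x k)) -> X (ultralim F x).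
Proof.
move=> FU Xc Xx; apply: (@closed_cvg nat (config d) F _ x X Xc _ (ultralim F x) (ultralim_cvg FU)).
exact: nearW.
Qed.

(** The sets [S k] converge along a nonprincipal ultrafilter to some [S], and so
    do, for a fixed pattern [u], points [x k] of [X] realising [u] on [S k].
    Each index of [S] lies in almost every [S k], so the limit point, which is in
    the closed set [X], realises [u] on [S].  Counts in a fixed box pass to the
    limit because a finite box is stabilised by almost every [k]. *)
Lemma independent_compactness (R : realType) (d : nat) (X : set (config d))
    (scale : nat -> multi_index d) (c : nat -> R) :
  is_shift X ->
  (forall k, exists S, independent X S /\
    forall j, (j < k)%N -> c j <= (count_in S (scale j))%:R) ->
  exists S, independent X S /\ forall j, c j <= (count_in S (scale j))%:R.
Proof.
move=> [Xc _] /choice[S SP].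
have [F [FU Foo]] := ultraFilterLemma (eventually_filter).
pose s k : config d := fun i => `[< S k i >].
exists [set i | ultralim F s i]; split=> [u|j].
  have /choice[x xP] : forall k, exists x, X x /\ forall i, S k i -> x i = u i.
    by move=> k; exact: (SP k).1 u.
  exists (ultralim F x); split; first by apply: ultralim_closed => // k; exact: (xP k).1.
  move=> i /= si.
  have [k [<- sk]] := filter_ex (filterI (ultralim_near x i FU) (ultralim_near s i FU)).
  apply: (xP k).2; apply/asboolP; rewrite -/(s k i) sk; exact: si.
have Fj : F [set k | (j < k)%N] by apply: Foo; exists j.+1.
have Fb : F [set k | forall b : box (scale j), s k (box_index b) = ultralim F s (box_index b)].
  by apply: filter_forall => b; exact: ultralim_near.
have [k [jk kP]] := filter_ex (filterI Fj Fb).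
apply: le_trans ((SP k).2 j jk) _; rewrite ler_nat; apply: subset_leq_card.
apply/fintype.subsetP => b; rewrite !inE => Sb.
have := kP b; rewrite {1}/s asboolT // => <-.
Qed.

(** * Largest independence sets in a box, and averaging over windows *)

Definition max_indep (d : nat) (X : set (config d)) (n : multi_index d) : nat :=
  \max_(A : {set box n} | `[< independent X [set i | exists2 c, c \in A & box_index c = i] >]) #|A|.

Lemma count_le_max_indep (d : nat) (X : set (config d)) (S : set (multi_index d))
    (n : multi_index d) :
  independent X S -> (count_in S n <= max_indep X n)%N.
Proof.
move=> indS; apply: leq_bigmax_cond; apply/asboolP; apply: independent_sub indS.
by move=> i [c + <-]; rewrite inE => /asboolP.
Qed.

(** Shattering is finitary independence, for blocks anchored at the origin. *)
Lemma shatters_independent (d : nat) (X : set (config d)) (n : multi_index d)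
    (A : {set box n}) :
  shatters (blocks X n) A ->
  independent X [set i | exists2 c, c \in A & box_index c = i].
Proof.
move=> /shattersP shA u; have [b /blocksP[x Xx xb] bu] := shA [ffun c => u (box_index c)].
by exists x; split=> // i [c cA <-]; rewrite xb bu // ffunE.
Qed.

Lemma shattered_le_max_indep (d : nat) (X : set (config d)) (n : multi_index d)
    (A : {set box n}) :
  shatters (blocks X n) A -> (#|A| <= max_indep X n)%N.
Proof.
by move=> shA; apply: leq_bigmax_cond; apply/asboolP; exact: shatters_independent.
Qed.

Lemma max_indepP (d : nat) (X : set (config d)) (n : multi_index d) :
  X !=set0 -> exists2 S, independent X S & count_in S n = max_indep X n.
Proof.
move=> [x Xx].
have [|A AP AE] := @eq_bigmax_cond _ [pred A : {set box n} |
    `[< independent X [set i | exists2 c, c \in A & box_index c = i] >]] (fun A => #|A|).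
  apply/card_gt0P; exists finset.set0; apply: asboolT => u.
  by exists x; split=> // i [c]; rewrite inE.
rewrite (_ : max_indep X n = #|A|); last exact: AE.
exists [set i | exists2 c, c \in A & box_index c = i]; first exact/asboolP.
apply: eq_card => c; rewrite inE; apply/asboolP/idP => [[e eA /box_index_inj <-//]|cA].
by exists c.
Qed.

Lemma max_indep_le (d : nat) (X : set (config d)) (n : multi_index d) :
  (max_indep X n <= \prod_k n k)%N.
Proof. by apply/bigmax_leqP => A _; rewrite -card_box; exact: max_card. Qed.

Definition cube (d N : nat) : multi_index d := [ffun=> N].

Lemma prod_cube (d N : nat) : (\prod_k cube d N k = N ^ d)%N.
Proof. by under eq_bigr do rewrite ffunE; rewrite prod_nat_const card_ord. Qed.

Lemma card_box_cube (d N : nat) : #|{: box (cube d N)}| = (N ^ d)%N.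
Proof. by rewrite card_box prod_cube. Qed.

Lemma ltn_cube (d N : nat) (c : box (cube d N)) (k : 'I_d) : (c k < N)%N.
Proof. by apply: leq_trans (ltn_ord (c k)) _; rewrite ffunE. Qed.

(** Shifting by [b] only loses points within distance [n] of the lower faces of
    the cube, of which there are at most [N^d - (N - n)^d]. *)
Lemma count_shifted_ge (d n N : nat) (S : set (multi_index d)) (b : multi_index d) :
  (n <= N)%N -> (forall k, b k < n)%N ->
  (count_in S (cube d N) + (N - n) ^ d <=
   #|[set c : box (cube d N) | `[< S (b + box_index c)%R >]]%SET| + N ^ d)%N.
Proof.
move=> nN bn.
pose A := [set c : box (cube d N) | `[< S (box_index c) >]]%SET.
pose B := [set c : box (cube d N) | [forall k, n <= c k]%N]%SET.
have cB : ((N - n) ^ d <= #|B|)%N.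
  have lt (c : box (cube d (N - n))) k : (c k + n < cube d N k)%N.
    by rewrite [X in (_ < X)%N]ffunE; have := ltn_cube c k; lia.
  pose phi c : box (cube d N) := [ffun k => Ordinal (lt c k)].
  have phiE c k : phi c k = (c k + n)%N :> nat := congr1 val (ffunE _ k).
  have phi_inj : injective phi.
    move=> c e ce; apply/ffunP => k; apply: val_inj => /=.
    by apply: (@addIn n); rewrite -!phiE ce.
  rewrite -card_box_cube -cardsT -(card_imset _ phi_inj); apply: subset_leq_card.
  apply/fintype.subsetP => _ /imsetP[c _ ->]; rewrite inE; apply/forallP => k.
  by rewrite phiE leq_addl.
have lt (c : box (cube d N)) k : (c k - b k < cube d N k)%N.
  by apply: leq_ltn_trans (leq_subr _ _) (ltn_ord _).
pose psi c : box (cube d N) := [ffun k => Ordinal (lt c k)].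
have psi_val c k : psi c k = (c k - b k)%N :> nat := congr1 val (ffunE _ k).
have psiE c : c \in B -> box_index c = b + box_index (psi c).
  rewrite inE => /forallP cn; apply/ffunP => k; rewrite multi_index_addE [LHS]ffunE [box_index _ k]ffunE psi_val.
  by rewrite subnKC // ltnW // (leq_trans (bn k)).
have psi_inj : {in A :&: B &, injective psi}.
  move=> c e /finset.setIP[_ cB'] /finset.setIP[_ eB'] ce; apply: box_index_inj.
  by rewrite (psiE _ cB') (psiE _ eB') ce.
have cAB : (#|A :&: B| <= #|[set c : box (cube d N) | `[< S (b + box_index c)%R >]]%SET|)%N.
  rewrite -(card_in_imset psi_inj); apply: subset_leq_card.
  apply/fintype.subsetP => _ /imsetP[c /finset.setIP[cA cB'] ->]; rewrite inE -psiE //.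
  by move: cA; rewrite inE.
have : (#|A :|: B| <= N ^ d)%N by rewrite -card_box_cube; exact: max_card.
have := cardsUI A B; rewrite -[count_in _ _]/#|A|; lia.
Qed.

(** Double counting of the pairs (window, position in the window): up to the
    boundary, every point of [S] lies in [n^d] windows of side [n]. *)
Lemma sum_count_translate (d n N : nat) (S : set (multi_index d)) :
  (n <= N)%N ->
  (n ^ d * (count_in S (cube d N) + (N - n) ^ d) <=
   \sum_(c : box (cube d N)) count_in (translate S (box_index c)) (cube d n)
     + n ^ d * N ^ d)%N.
Proof.
move=> nN.
have -> : (\sum_(c : box (cube d N)) count_in (translate S (box_index c)) (cube d n) =
  \sum_(b : box (cube d n)) #|[set c : box (cube d N) | `[< S (box_index b + box_index c)%R >]]%SET|)%N.
  under eq_bigr do rewrite /count_in -sum1_card big_mkcond /=.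
  rewrite exchange_big /=; apply: eq_bigr => b _.
  by rewrite -sum1_card [RHS]big_mkcond /=; apply: eq_bigr => c _; rewrite !inE.
rewrite -[(n ^ d)%N]card_box_cube -!sum_nat_const -big_split /=; apply: leq_sum => b _.
by apply: count_shifted_ge => // k; rewrite ffunE ltn_cube.
Qed.

(** * An independence set of positive upper density *)

Lemma bernoulli_ge (R : realFieldType) (d : nat) (t : R) :
  0 <= t <= 1 -> 1 - d%:R * t <= (1 - t) ^+ d.
Proof.
move=> /andP[t0 t1]; elim: d => [|d IH]; first by rewrite expr0; lra.
rewrite exprS; apply: le_trans (ler_wpM2l _ IH); last by lra.
have : 0 <= d%:R * (t * t) by rewrite !mulr_ge0.
rewrite -natr1; lra.
Qed.

Lemma cube_interior_ge (R : realFieldType) (d n N : nat) (e : R) :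
  0 < e -> (n <= N)%N -> d%:R * n%:R <= e * N%:R ->
  (1 - e) * (N ^ d)%N%:R <= ((N - n) ^ d)%N%:R.
Proof.
move=> e0 nN dnN; have [N0|N0] := posnP N.
  have -> : (N - n = N)%N by lia.
  rewrite -[leRHS]mul1r ler_wpM2r //; lra.
have N0' : 0 < N%:R :> R by rewrite ltr0n.
have tE : (N - n)%:R = N%:R * (1 - n%:R / N%:R) :> R.
  by rewrite natrB // mulrBr mulr1 mulrCA divff ?mulr1 // gt_eqF.
rewrite !natrX tE exprMn mulrC ler_wpM2l ?exprn_ge0 //.
apply: le_trans (bernoulli_ge d _); last first.
  by rewrite divr_ge0 //= ler_pdivrMr // mul1r ler_nat.
by rewrite lerD2l lerN2 mulrA ler_pdivrMr.
Qed.

(** The lower limit, characterised as used below: eventual lower bounds, and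
    upper bounds attained arbitrarily far. *)
Lemma liminf_exists (R : realType) (r : nat -> R) (a b : R) :
  (exists M, forall N, (M <= N)%N -> a <= r N <= b) ->
  exists D, [/\ a <= D,
    forall e, 0 < e -> exists M, forall N, (M <= N)%N -> D - e <= r N &
    forall e M, 0 < e -> exists2 N, (M <= N)%N & r N <= D + e].
Proof.
move=> [M0 rab]; pose E := [set c | exists M, forall N, (M <= N)%N -> c <= r N].
have Ea : E a by exists M0 => N /rab /andP[].
have Es : has_sup E.
  split; first by exists a.
  exists b => c [M cr]; apply: le_trans (cr (maxn M M0) _) _; first exact: leq_maxl.
  by have /andP[] := rab _ (leq_maxr M M0).
exists (sup E); split=> [|e e0|e M e0].
- exact: ub_le_sup Es.2 _ Ea.
- have [c [M cr] cE] := sup_adherent e0 Es.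
  by exists M => N /cr; apply: le_trans; exact: ltW.
- apply: contrapT => no; have : E (sup E + e).
    exists M => N MN; rewrite leNgt; apply/negP => /ltW rN.
    by apply: no; exists N.
  by move=> /(ub_le_sup Es.2); rewrite gerDl leNgt e0.
Qed.

Lemma sum_half_le2 (R : realFieldType) (k : nat) : \sum_(j < k) (1 / 2 : R) ^+ j <= 2.
Proof.
suff -> : \sum_(j < k) (1 / 2 : R) ^+ j = 2 - 2 * (1 / 2) ^+ k.
  have : 0 <= (1 / 2 : R) ^+ k by rewrite exprn_ge0 // divr_ge0.
  lra.
elim: k => [|k IH]; first by rewrite big_ord0 expr0; lra.
rewrite big_ord_recr /= IH exprS; lra.
Qed.

(** Take an independence set [T] of maximal size in a huge cube of side [N] and
    let [c] range over the windows.  The deficit of the window at scale [j] is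
    [(a j - cnt j c) / v j].  It is nonnegative, its average over [c] is at most
    [D / 16 * 2^-j + 2 e], and it is at least [D / 4] for a window of density
    below [D / 2].  If every window failed at some scale, the total average
    deficit would be at least [D / 4], but it is at most [D / 8 + D / 16]. *)
Lemma dense_at_many_scales (R : realType) (d : nat) (X : set (config d)) (D : R)
    (n : nat -> nat) :
  is_shift X -> X !=set0 -> 0 < D -> (forall j, 0 < n j)%N ->
  (forall j, 3 / 4 * D * (n j ^ d)%N%:R <= (max_indep X (cube d (n j)))%:R) ->
  (forall j, (max_indep X (cube d (n j)))%:R <=
             (D + D / 16 * (1 / 2) ^+ j) * (n j ^ d)%N%:R) ->
  (forall e, 0 < e -> exists M, forall N, (M <= N)%N ->
     (D - e) * (N ^ d)%N%:R <= (max_indep X (cube d N))%:R) ->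
  forall k, exists S, independent X S /\
    forall j, (j < k)%N -> D / 2 * (n j ^ d)%N%:R <= (count_in S (cube d (n j)))%:R.
Proof.
move=> Xs X0 D0 n0 alow aup Dlow k.
(* [e] bounds two relative losses, at most [2 k e <= D / 16] over the [k] scales:
   the distance of [a N / N^d] below [D], and the boundary layer of the cube *)
pose e : R := D / (32 * k.+1%:R).
have e0 : 0 < e by rewrite divr_gt0 // mulr_gt0.
have ek : 2 * e * k%:R <= D / 16.
  rewrite /e -[k.+1%:R]natr1; set K : R := k%:R; have K0 : 0 <= K by rewrite ler0n.
  have -> : 2 * (D / (32 * (K + 1))) * K = D / 16 * (K / (K + 1)) by field; lra.
  rewrite -[leRHS]mulr1 ler_wpM2l //; first by lra.
  by rewrite ler_pdivrMr; lra.
have [M HM] := Dlow e e0.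
(* a side [N >= d n_j / e] makes the boundary layer at scale [j] negligible *)
pose f j := (n j + (Num.trunc (d%:R * (n j)%:R / e)).+1)%N.
pose N := (M + (\sum_(j < k) f j).+1)%N.
have fN (j : 'I_k) : (f j <= N)%N by rewrite /N (bigD1 j) //=; lia.
have N0 : (0 < N)%N by rewrite /N; lia.
have nN (j : 'I_k) : (n j <= N)%N by apply: leq_trans (fN j); rewrite leq_addr.
have interior (j : 'I_k) : (1 - e) * (N ^ d)%N%:R <= ((N - n j) ^ d)%N%:R.
  apply: cube_interior_ge => //; rewrite [leRHS]mulrC -ler_pdivrMr //.
  apply: (@le_trans _ _ (f j)%:R); last by rewrite ler_nat.
  apply: ltW; apply: lt_le_trans (truncnS_gt _) _; by rewrite ler_nat leq_addl.
have [T indT cT] := max_indepP (cube d N) X0.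
have [c Hc] : exists c : box (cube d N), forall j, (j < k)%N ->
    D / 2 * (n j ^ d)%N%:R <= (count_in (translate T (box_index c)) (cube d (n j)))%:R; last first.
  by exists (translate T (box_index c)); split=> //; exact: independent_translate.
apply: contrapT => noc.
set V : R := (N ^ d)%N%:R in interior.
have V0 : 0 < V by rewrite ltr0n expn_gt0 N0.
pose v j : R := (n j ^ d)%N%:R.
have v0 j : 0 < v j by rewrite ltr0n expn_gt0 n0.
pose a j : R := (max_indep X (cube d (n j)))%:R.
pose cnt j (c : box (cube d N)) : R :=
  (count_in (translate T (box_index c)) (cube d (n j)))%:R.
have cnta j c : cnt j c <= a j.
  by rewrite ler_nat; apply: count_le_max_indep; exact: independent_translate.
have lowc (c : box (cube d N)) : D / 4 <= \sum_(j < k) (a j - cnt j c) / v j.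
  have [j cj] : exists j : 'I_k, cnt j c < D / 2 * v j.
    apply: contrapT => noj; apply: noc; exists c => j jk.
    by rewrite leNgt; apply/negP => h; apply: noj; exists (Ordinal jk).
  rewrite (bigD1 j) //= -[leLHS]addr0; apply: lerD; last first.
    by apply: sumr_ge0 => i _; rewrite divr_ge0 ?subr_ge0 // ltW.
  rewrite ler_pdivlMr //; have := alow j; rewrite -/(a j) -/(v j).
  by have := ltW cj; lra.
have upj (j : 'I_k) : \sum_c (a j - cnt j c) / v j <= V * (D / 16 * (1 / 2) ^+ j + 2 * e).
  rewrite -mulr_suml ler_pdivrMr // sumrB sumr_const card_box_cube -mulr_natl -/V.
  have := sum_count_translate T (nN j); rewrite -(ler_nat R) cT natrD natrM natr_sum natrD natrM.
  rewrite -/V -/(v j) -[\sum_(_ : box _) _]/(\sum_c cnt j c) => low.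
  have l1 : v j * ((D - e) * V + (1 - e) * V) <=
      v j * ((max_indep X (cube d N))%:R + ((N - n j) ^ d)%N%:R).
    rewrite ler_wpM2l ?(ltW (v0 j)) // lerD // HM //; rewrite /N; lia.
  have l2 : V * a j <= V * ((D + D / 16 * (1 / 2) ^+ j) * v j).
    by rewrite ler_wpM2l ?(ltW V0) // aup.
  have := le_trans l1 low; lra.
have : V * (D / 4) <= V * (D / 8 + D / 16).
  apply: (@le_trans _ _ (\sum_(c : box (cube d N)) \sum_(j < k) (a j - cnt j c) / v j)).
    by rewrite mulr_natl -card_box_cube -sumr_const; apply: ler_sum.
  rewrite exchange_big /=; apply: le_trans (ler_sum _ (fun j _ => upj j)) _.
  rewrite -mulr_sumr ler_wpM2l ?(ltW V0) // big_split /= lerD //.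
    by rewrite -mulr_sumr; have := @sum_half_le2 R k; nra.
  by rewrite sumr_const card_ord -[(2 * e) *+ k]mulr_natr.
by rewrite ler_pM2l //; lra.
Qed.

Lemma density_in_boxE (R : realType) (d : nat) (S : set (multi_index d)) (n : multi_index d) :
  density_in_box R S n = (count_in S n)%:R / (\prod_k n k)%N%:R.
Proof.
rewrite /density_in_box card_box; congr (_%:R / _).
by apply: eq_card => c; rewrite [RHS]inE.
Qed.

(** The sides [n j] are chosen where the optimal density nearly equals its lower
    limit [D], as required to compare averages with maxima. *)
Lemma independent_dense (R : realType) (d : nat) (X : set (config d)) (delta : R) :
  is_shift X -> X !=set0 -> 0 < delta ->
  (forall N, (0 < N)%N -> delta * (N ^ d)%N%:R <= (max_indep X (cube d N))%:R) ->
  exists S, independent X S /\ (0 < upper_density R S)%E.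
Proof.
move=> Xs X0 delta0 alow.
have V0 N : (0 < N)%N -> 0 < (N ^ d)%N%:R :> R by move=> N0; rewrite ltr0n expn_gt0 N0.
have [|D [dD Dlow Dup]] := @liminf_exists R
    (fun N => (max_indep X (cube d N))%:R / (N ^ d)%N%:R) delta 1.
  exists 1%N => N N0; rewrite ler_pdivlMr ?V0 // alow //= ler_pdivrMr ?V0 // mul1r.
  by rewrite ler_nat -prod_cube max_indep_le.
have D0 : 0 < D by apply: lt_le_trans dD.
have D40 : 0 < D / 4 by lra.
have [M0 HM0] := Dlow _ D40.
have /choice[n nP] : forall j, exists N, [/\ (j <= N)%N, (M0 <= N)%N, (0 < N)%N &
    (max_indep X (cube d N))%:R / (N ^ d)%N%:R <= D + D / 16 * (1 / 2) ^+ j].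
  move=> j; have ej : 0 < D / 16 * (1 / 2) ^+ j by rewrite mulr_gt0 ?exprn_gt0 //; lra.
  have [N] := Dup _ (j + M0 + 1)%N ej; exists N; split=> //; lia.
have [|S [indS HS]] := @independent_compactness R d X (fun j => cube d (n j))
    (fun j => D / 2 * (n j ^ d)%N%:R) Xs.
  apply: dense_at_many_scales => // [j|j|j|e e0].
  - by have [] := nP j.
  - have [_ M0n n0 _] := nP j; rewrite -ler_pdivlMr ?V0 //.
    by apply: le_trans (HM0 _ M0n); lra.
  - by have [_ _ n0] := nP j; rewrite ler_pdivrMr ?V0.
  - have [M HM] := Dlow e e0; exists (maxn M 1) => N; rewrite geq_max => /andP[MN N0].
    by rewrite -ler_pdivlMr ?V0 // HM.
exists S; split=> //; apply: (@lt_le_trans _ _ (D / 2)%:E); first by rewrite lte_fin; lra.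
apply: le_ereal_inf_tmp => _ [N _ <-]; apply: le_ereal_sup_tmp.
have [Nn _ n0 _] := nP N.
exists (density_in_box R S (cube d (n N)))%:E.
  by exists (cube d (n N)) => // k; rewrite ffunE.
by rewrite lee_fin density_in_boxE prod_cube ler_pdivlMr ?V0.
Qed.

(** * Entropy versus density *)

(** The outer infimum ranges over lower bounds for the sides, so a positive value
    gives one density that is exceeded in arbitrarily large boxes. *)
Lemma upper_density_gt0_frequently (R : realType) (d : nat) (S : set (multi_index d)) :
  (0 < upper_density R S)%E ->
  exists2 delta : R, 0 < delta &
    forall N, exists2 n, orthant d N n & delta * (\prod_k n k)%N%:R <= (count_in S n)%:R.
Proof.
move=> S0.
have [delta delta0 dS] : exists2 delta : R, 0 < delta & (delta%:E < upper_density R S)%E.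
  case: (upper_density R S) S0 => [r||//]; last by exists 1 => //; rewrite ltry.
  by rewrite lte_fin => r0; exists (r / 2); rewrite ?lte_fin; lra.
exists delta => // N.
have /ereal_sup_gt[_ [n nN <-]] : (delta%:E <
    ereal_sup [set (density_in_box R S n)%:E | n in orthant d (maxn N 1)])%E.
  by apply: lt_le_trans dS _; apply: ereal_inf_lbound; exists (maxn N 1).
rewrite lte_fin density_in_boxE => /ltW dn; exists n.
  by move=> k; apply: leq_trans (nN k); rewrite leq_maxl.
rewrite -ler_pdivlMr // ltr0n; apply: prodn_gt0 => k.
by apply: leq_trans (nN k); rewrite leq_maxr.
Qed.

Theorem theorem1p2 (R : realType) (d : nat) (d_ge2 : (2 <= d)%N)
    (X : set (config d)) (X_shift : is_shift X) :
  (0 < entropy R X)%E <->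
  exists S : set (multi_index d), independent X S /\ (0 < upper_density R S)%E.
Proof.
split=> [h0|[S [indS /upper_density_gt0_frequently[delta delta0 HS]]]].
  have [X0|X0] := eqVneq X set0; first by rewrite X0 entropy_set0 in h0.
  have {X0} X0 : X !=set0 by apply/set0P.
  have [L [LE Ll _]] := @entropy_fekete R d X X_shift X0.
  have L0 : 0 < L by rewrite LE lte_fin in h0.
  apply: (@independent_dense R d X (L ^+ 2 / 9)) => // [|N N0].
    by rewrite divr_gt0 ?exprn_gt0.
  have c0 k : (0 < cube d N k)%N by rewrite ffunE.
  have [||A shA cA] := @shatters_large R _ (blocks X (cube d N)) L L0.
  - by rewrite card_box_cube expn_gt0 N0.
  - have nb0 := num_blocks_gt0 (cube d N) X_shift X0.
    rewrite -num_blocksE // -[leRHS]lnK ?posrE ?ltr0n // ler_expR card_box.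
    exact: Ll.
  rewrite -card_box_cube; apply: le_trans cA _.
  by rewrite ler_nat shattered_le_max_indep.
have X0 : X !=set0 by have [x [Xx _]] := indS (fun=> true); exists x.
have [L [-> _ Lu]] := @entropy_fekete R d X X_shift X0.
have ln20 : 0 < ln (2 : R) by rewrite ln_gt0 // ltr1n.
have e0 : 0 < delta * ln 2 / 2 by rewrite !mulr_gt0.
have [N HN] := Lu _ e0; have [n nN Sn] := HS (maxn N 1).
have nN' : orthant d N n by move=> k; apply: leq_trans (nN k); rewrite leq_maxl.
have v0 : 0 < (\prod_k n k)%N%:R :> R.
  by rewrite ltr0n prodn_gt0 // => k; apply: leq_trans (nN k); rewrite leq_maxr.
have : (count_in S n)%:R * ln 2 <= ln (num_blocks X n)%:R :> R.
  rewrite mulr_natl -lnXn ?ltr0n // -natrX ler_ln ?posrE ?ltr0n ?expn_gt0 //.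
    by rewrite ler_nat exp_count_le_num_blocks.
  exact: num_blocks_gt0.
move=> /le_trans/(_ (HN n nN')) h.
have := le_trans (ler_wpM2r (ltW ln20) Sn) h.
rewrite mulrAC ler_pM2r // lte_fin; lra.
Qed.
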